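(* Let $\mathcal{H}$ be a hypergraph with rank $r$. If $\lambda$ is an eigenvalue of the adjacency matrix $\mathbf{A}_{\mathcal{L}}$ of the line multigraph $\mathcal{L}(\mathcal{H})$, then $\lambda \geq -r$.
   Context: A hypergraph $\mathcal{H}=(V,E)$ consists of a finite set $V$ of vertices and a set $E$ of non-empty subsets of $V$, called hyperedges. All hypergraphs are assumed simple (no hyperedge has cardinality one and no hyperedge is contained in another) and connected (any two vertices are joined by a path, i.e. an alternating sequence of distinct vertices and hyperedges in which each hyperedge contains the vertices immediately before and after it). The rank of $\mathcal{H}$ is the largest cardinality of its hyperedges (so $E\neq\emptyset$ when the rank is mentioned). The line multigraph $\mathcal{L}(\mathcal{H})$ is the multigraph with vertex set $E$ in which two distinct vertices $e,f\in E$ are joined by exactly $|e\cap f|$ edges (no loops). The adjacency matrix of a multigraph has zero diagonal, and for $u\neq v$ its $(u,v)$ entry is the number of edges joining $u$ and $v$. *)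

(* Defs.v *)
From HB Require Import structures.
From mathcomp Require Import all_boot all_order all_algebra.
Set Implicit Arguments.
Unset Strict Implicit.
Unset Printing Implicit Defensive.
Import GRing.Theory Num.Theory.
Local Open Scope ring_scope.

Record hypergraph (V : finType) := Hypergraph {
  hedges : {set {set V}};
  hedges_nonempty : set0 \notin hedges
}.

Definition simple (V : finType) (H : hypergraph V) : Prop :=
  (forall e, e \in hedges H -> #|e| <> 1%N) /\
  (forall e f, e \in hedges H -> f \in hedges H -> e \subset f -> e = f).

(* The alternating sequence x, e_1, v_1, ..., e_k, v_k is encoded by its first
   vertex x and the list [:: (e_1, v_1); ...; (e_k, v_k)]. *)
Fixpoint alternating (V : finType) (H : hypergraph V) (x : V)
    (s : seq ({set V} * V)) : bool :=
  if s is (e, v) :: s' then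
    [&& e \in hedges H, x \in e, v \in e & alternating H v s']
  else true.

Definition hpath (V : finType) (H : hypergraph V) (x y : V)
    (s : seq ({set V} * V)) : bool :=
  [&& alternating H x s, uniq (x :: unzip2 s), uniq (unzip1 s)
    & last x (unzip2 s) == y].

Definition connected (V : finType) (H : hypergraph V) : Prop :=
  forall x y : V, exists s, hpath H x y s.

Definition rank (V : finType) (H : hypergraph V) : nat :=
  (\max_(e in hedges H) #|e|)%N.

(* [mult u v] is the number of edges joining u and v. *)
Record multigraph := Multigraph {
  vertex :> finType;
  mult : vertex -> vertex -> nat;
  mult_sym : forall u v, mult u v = mult v u;
  mult_loopless : forall u, mult u u = 0%N
}.

Definition adjacency (R : nzRingType) (G : multigraph) : 'M[R]_#|G| :=
  \matrix_(i, j) (mult (enum_val i) (enum_val j))%:R.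

Section LineMultigraph.
Variables (V : finType) (H : hypergraph V).

Definition hedge : finType := {e : {set V} | e \in hedges H}.

Definition line_mult (e f : hedge) : nat :=
  if e == f then 0%N else #|val e :&: val f|.

Lemma line_mult_sym e f : line_mult e f = line_mult f e.
Proof. by rewrite /line_mult eq_sym setIC. Qed.

Lemma line_mult_loopless e : line_mult e e = 0%N.
Proof. by rewrite /line_mult eqxx. Qed.

Definition line_multigraph : multigraph :=
  Multigraph line_mult_sym line_mult_loopless.

End LineMultigraph.

(* Main.v *)
(* With B the hyperedge-vertex incidence matrix, B B^T = A + D where D is the
   diagonal matrix of hyperedge sizes.  For a row eigenvector v of A,
   0 <= |v B|^2 = lambda |v|^2 + v D v^T <= (lambda + r) |v|^2. *)
Require Import Defs.
From mathcomp Require Import all_boot all_order all_algebra.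
Import GRing.Theory Num.Theory.
Local Open Scope ring_scope.

Definition hedge_at (V : finType) (H : hypergraph V)
    (i : 'I_#|line_multigraph H|) : {set V} :=
  val (enum_val i : hedge H).

Definition incidence (R : nzRingType) (V : finType) (H : hypergraph V) :
    'M[R]_(#|line_multigraph H|, #|V|) :=
  \matrix_(i, j) (enum_val j \in hedge_at V H i)%:R.

Definition hedge_sizes (R : nzRingType) (V : finType) (H : hypergraph V) :
    'rV[R]_#|line_multigraph H| :=
  \row_i #|hedge_at V H i|%:R.

(** Each entry of the product sums products of membership indicators, hence counts the common
    vertices of two hyperedges: an edge multiplicity off the diagonal, a hyperedge size on it. *)
Lemma incidence_mul_tr (R : nzRingType) (V : finType) (H : hypergraph V) :
  incidence R V H *m (incidence R V H)^T =
  adjacency R (line_multigraph H) + diag_mx (hedge_sizes R V H).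
Proof.
apply/matrixP => i j; rewrite !mxE.
have -> : \sum_k incidence R V H i k * (incidence R V H)^T k j =
          #|hedge_at V H i :&: hedge_at V H j|%:R.
  rewrite -sum1_card natr_sum [RHS]big_mkcond.
  (* The cardinality sums over elements of [V], the matrix product over their ordinal ranks. *)
  rewrite [RHS](reindex_onto enum_val enum_rank) /=;
    last by move=> x _; exact: enum_rankK.
  rewrite [RHS](eq_bigl xpredT) => [|k]; last by rewrite enum_valK eqxx.
  apply: eq_bigr => k _; rewrite !mxE inE.
  by case: (_ \in _); case: (_ \in _); rewrite ?mulr0 ?mul0r ?mulr1.
rewrite /= /line_mult (inj_eq enum_val_inj); have [<-|_] := eqVneq i j.
  by rewrite setIid add0r.
by rewrite mulr0n addr0.
Qed.

Lemma mulmx_tr_sqr (R : comNzRingType) (n : nat) (v : 'rV[R]_n) :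
  (v *m v^T) 0 0 = \sum_i v 0 i ^+ 2.
Proof. by rewrite mxE; apply: eq_bigr => i _; rewrite mxE expr2. Qed.

Lemma card_hedge_at (V : finType) (H : hypergraph V)
    (i : 'I_#|line_multigraph H|) :
  (#|hedge_at V H i| <= rank H)%N.
Proof.
by apply: leq_bigmax_cond; exact: (valP (enum_val i : hedge H)).
Qed.

Theorem proposition4p4 (R : realFieldType) (V : finType) (H : hypergraph V)
    (H_simple : simple H) (H_connected : connected H)
    (H_edge : hedges H != set0) (lambda : R) :
  eigenvalue (adjacency R (line_multigraph H)) lambda ->
  - (rank H)%:R <= lambda.
Proof.
case/eigenvalueP => v vA v_neq0.
(* In an ordered field a sum of squares vanishes only if every term does. *)
have norm_gt0 : 0 < \sum_i v 0 i ^+ 2.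
  rewrite lt0r sumr_ge0 ?andbT => [|i _]; last exact: sqr_ge0.
  apply: contra v_neq0 => /eqP/psumr_eq0P v0.
  apply/eqP/rowP => i; rewrite mxE; apply/eqP; rewrite -sqrf_eq0.
  by apply/eqP/v0 => // j _; exact: sqr_ge0.
have vB_ge0 : 0 <= \sum_j (v *m incidence R V H) 0 j ^+ 2.
  by apply: sumr_ge0 => j _; exact: sqr_ge0.
(* Multiplying [lambda + r] by the positive squared norm of [v] leaves its sign unchanged. *)
rewrite -subr_ge0 opprK -(pmulr_lge0 _ norm_gt0) mulrDl.
apply: Order.POrderTheory.le_trans vB_ge0 _.
rewrite -mulmx_tr_sqr trmx_mul mulmxA -(mulmxA v) incidence_mul_tr.
rewrite mulmxDr vA mulmxDl -scalemxAl [(_ + _ : 'M_1) 0 0]mxE.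
rewrite [(_ *: _ : 'M_1) 0 0]mxE mulmx_tr_sqr lerD2l.
(* The terms in [lambda] have cancelled. What remains holds coordinatewise: the square of [v 0 i] is
   weighted by a hyperedge size on the left and by the rank on the right. *)
rewrite [(_ *m _ : 'M_1) 0 0]mxE mulr_sumr; apply: ler_sum => i _.
rewrite mul_mx_diag !mxE -mulrA mulrCA -expr2.
by rewrite ler_wpM2r ?sqr_ge0 // ler_nat card_hedge_at.
Qed.
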